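(* Let $A_1,A_2$ be separable unital C*-algebras with a common unital C*-subalgebra $B$ and conditional expectations $E_k:A_k\to B$, $k=1,2$. If both $E_1$ and $E_2$ are homomorphisms, then the vertex-reduced amalgamated free product $A_v=A_1\overset{v}{\underset{B}{*}}A_2$ is canonically isomorphic to $$A_1\underset{B}{\oplus}A_2:=\{(a_1,a_2)\in A_1\oplus A_2\,:\,E_1(a_1)=E_2(a_2)\}.$$
   Context: ''Canonically'' means compatibly with the canonical maps of $A_1$ and $A_2$; the canonical maps into $A_1\oplus_BA_2$ are $a\mapsto(a,E_1(a))$ on $A_1$ and $a\mapsto(E_2(a),a)$ on $A_2$. All C*-algebras and Hilbert modules are separable. $A_f=A_1*_BA_2$ is the full amalgamated free product; $A_1,A_2$ are viewed as subalgebras of $A_f$. $\mathcal L_C(H)$ denotes the adjointable operators of a Hilbert $C$-module $H$. Construction of the vertex-reduced amalgamated free product. Let $A_k^\circ=\ker E_k$ and let $(K_k,\rho_k,\eta_k)$ be the GNS construction of $E_k$: $K_k$ is a Hilbert $B$-module, $\eta_k\in K_k$, $\rho_k:A_k\to\mathcal L_B(K_k)$ is a unital $*$-homomorphism, $K_k=\overline{\rho_k(A_k)\eta_k\cdot B}$, $\langle\eta_k,\rho_k(a)\eta_k\rangle=E_k(a)$. One has $K_k=\eta_k\cdot B\oplus K_k^\circ$ with $K_k^\circ=\overline{\mathrm{Span}}\{\rho_k(a)\eta_k\cdot b: a\in A_k^\circ,b\in B\}$, and $\rho_k(B)$ preserves $K_k^\circ$. Write $\overline 1=2$, $\overline 2=1$.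 Let $I$ be the set of finite sequences $\underline i=(i_1,\dots,i_n)\in\{1,2\}^n$, $n\ge1$, with $i_s\ne i_{s+1}$ for all $s$. For $\underline i\in I$ let $H_{\underline i}$ be the Hilbert $A_{i_n}$-module $K_{i_1}\otimes_B K_{i_2}^\circ\otimes_B\cdots\otimes_B K_{i_{n-1}}^\circ\otimes_B A_{i_n}$ if $n\ge3$, $K_{i_1}\otimes_B A_{i_2}$ if $n=2$, $A_{i_1}$ if $n=1$; $A_{i_1}$ acts on the left by $\lambda_{\underline i}=\rho_{i_1}\otimes\mathrm{id}$ if $n\ge 2$ and by left multiplication if $n=1$. Let $H_{k,l}=\bigoplus H_{\underline i}$ and $\lambda_{k,l}=\bigoplus\lambda_{\underline i}:A_k\to\mathcal L_{A_l}(H_{k,l})$, the sums being over $\underline i\in I$ with $i_1=k$, $i_n=l$. Let $u_{k,k}:H_{k,k}\to H_{\overline k,k}$ be the unitary with $u_{k,k}\xi=\eta_{\overline k}\otimes\xi$ for $\xi\in A_k=H_{(k)}$, and, for $\underline i=(k,\underline i')$ with $n\ge2$ and $\xi=\rho_k(a)\eta_k\otimes\xi'\in H_{\underline i}$, where $\xi'\in K_{i_2}^\circ\otimes_B\cdots\otimes_B A_k\subset H_{\underline i'}$, $u_{k,k}\xi=\eta_{\overline k}\otimes\xi$ if $a\in A_k^\circ$ and $u_{k,k}\xi=\lambda_{\underline i'}(a)\xi'$ if $a\in B$. Let $\pi_k:A_f\to\mathcal L_{A_k}(H_{k,k})$ be the unique unital $*$-homomorphism with $\pi_k(a)=\lambda_{k,k}(a)$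 for $a\in A_k$ and $\pi_k(a)=u_{k,k}^*\lambda_{\overline k,k}(a)u_{k,k}$ for $a\in A_{\overline k}$. The vertex-reduced amalgamated free product $A_v$ is the separation-completion of $A_f$ for the C*-seminorm $\|x\|_v=\max\{\|\pi_1(x)\|,\|\pi_2(x)\|\}$. *)

(* Defs.v *)
From HB Require Import structures.
From mathcomp Require Import all_boot all_order all_algebra complex.
From mathcomp Require Import all_classical all_reals.
From mathcomp Require Import prodnormedzmodule topology normedtype.

Set Implicit Arguments.
Unset Strict Implicit.
Unset Printing Implicit Defensive.

Import Order.TTheory GRing.Theory Num.Theory.
Import numFieldNormedType.Exports.

Local Open Scope classical_set_scope.
Local Open Scope complex_scope.
Local Open Scope ring_scope.

(* A complex Banach space with a product, a unit and an involution satisfying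
   the C*-identity. As for every normed module over R[i], the norm takes its
   values in R[i] (it is real and nonnegative there). The zero algebra is
   allowed. The product is a field of the mixin, not inherited from the ring
   hierarchy, because that hierarchy and the one of normed modules meet only
   in [numDomainType]; the [pzRingType] instance below gives it the usual ring
   notations. *)
HB.mixin Record isCStarAlgebra (R : realType) A
    & CompleteNormedModule R[i] A := {
  cstar_mul : A -> A -> A;
  cstar_one : A;
  star : A -> A;
  cstar_mulA : associative cstar_mul;
  cstar_mul1x : left_id cstar_one cstar_mul;
  cstar_mulx1 : right_id cstar_one cstar_mul;
  cstar_mulDl : left_distributive cstar_mul +%R;
  cstar_mulDr : right_distributive cstar_mul +%R;
  cstar_scaleAl : forall (c : R[i]) (x y : A),
    c *: cstar_mul x y = cstar_mul (c *: x) y;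
  cstar_scaleAr : forall (c : R[i]) (x y : A),
    c *: cstar_mul x y = cstar_mul x (c *: y);
  starK : involutive star;
  starD : {morph star : x y / x + y};
  starZ : forall (c : R[i]) (x : A), star (c *: x) = c^* *: star x;
  starM : forall x y : A, star (cstar_mul x y) = cstar_mul (star y) (star x);
  cstar_normM : forall x y : A, `|cstar_mul x y| <= `|x| * `|y|;
  cstar_norm_starM : forall x : A, `|cstar_mul (star x) x| = `|x| ^+ 2
}.

#[short(type="cstarAlgType")]
HB.structure Definition CStarAlgebra (R : realType) :=
  {A of isCStarAlgebra R A & CompleteNormedModule R[i] A}.

HB.instance Definition _ (R : realType) (A : cstarAlgType R) :=
  GRing.Zmodule_isPzRing.Build A (@cstar_mulA R A) (@cstar_mul1x R A)
    (@cstar_mulx1 R A) (@cstar_mulDl R A) (@cstar_mulDr R A).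

Section DirectSum.
Context (R : realType) (A1 A2 : cstarAlgType R).

HB.instance Definition _ := NormedModule.on (A1 * A2)%type.
HB.instance Definition _ := Pointed.on (A1 * A2)%type.

Lemma dsum_complete (F : set_system (A1 * A2)%type) :
  ProperFilter F -> cauchy F -> cvg F.
Proof.
move=> FF Fc.
have F1c : cauchy ((fst : A1 * A2 -> A1) @ F).
  move=> X entX; rewrite near_simpl -near2E near_map2; apply: Fc.
  apply: filterS (prod_entP entX (@entourageT A2)) => /= x.
  by case.
have F2c : cauchy ((snd : A1 * A2 -> A2) @ F).
  move=> X entX; rewrite near_simpl -near2E near_map2; apply: Fc.
  apply: filterS (prod_entP (@entourageT A1) entX) => /= x.
  by case.
have [l1 Fl1] : exists l : A1, (fst : A1 * A2 -> A1) @ F --> l.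
  by apply: (iffLR (@cvg_ex A1 _)); exact: (@cauchy_cvg A1 _ _ F1c).
have [l2 Fl2] : exists l : A2, (snd : A1 * A2 -> A2) @ F --> l.
  by apply: (iffLR (@cvg_ex A2 _)); exact: (@cauchy_cvg A2 _ _ F2c).
apply/cvg_ex; exists (l1, l2).
have -> : F = (fun x : A1 * A2 => (x.1, x.2)) @ F.
  by apply/funext => X; rewrite /fmap/=; congr F; apply/funext => -[].
exact: cvg_pair.
Qed.

HB.instance Definition _ :=
  Uniform_isComplete.Build (A1 * A2)%type dsum_complete.

Definition dsum_star (x : A1 * A2) : A1 * A2 := (star x.1, star x.2).

Let maxC (x : A1 * A2) : (`|x.1| >=< `|x.2|)%O.
Proof. by rewrite real_comparable ?normr_real. Qed.

Lemma dsum_scaleAl (c : R[i]) (x y : A1 * A2) : c *: (x * y) = (c *: x) * y.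
Proof. by congr pair; exact: cstar_scaleAl. Qed.

Lemma dsum_scaleAr (c : R[i]) (x y : A1 * A2) : c *: (x * y) = x * (c *: y).
Proof. by congr pair; exact: cstar_scaleAr. Qed.

Lemma dsum_starK : involutive dsum_star.
Proof. by case=> a b; rewrite /dsum_star /= !starK. Qed.

Lemma dsum_starD : {morph dsum_star : x y / x + y}.
Proof. by move=> x y; congr pair; exact: starD. Qed.

Lemma dsum_starZ (c : R[i]) (x : A1 * A2) :
  dsum_star (c *: x) = c^* *: dsum_star x.
Proof. by congr pair; exact: starZ. Qed.

Lemma dsum_starM (x y : A1 * A2) :
  dsum_star (x * y) = dsum_star y * dsum_star x.
Proof. by congr pair; exact: starM. Qed.

Lemma dsum_normM (x y : A1 * A2) : `|x * y| <= `|x| * `|y|.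
Proof.
rewrite !prod_normE /= comparable_ge_max; last exact: (maxC (x * y)).
apply/andP; split; (apply: le_trans; [exact: cstar_normM|]).
  by apply: ler_pM => //; rewrite comparable_le_max ?lexx.
by apply: ler_pM => //; rewrite comparable_le_max ?lexx ?orbT.
Qed.

Lemma dsum_norm_starM (x : A1 * A2) : `|dsum_star x * x| = `|x| ^+ 2.
Proof.
rewrite !prod_normE /= [X in Num.max X _]cstar_norm_starM.
rewrite [X in Num.max _ X]cstar_norm_starM.
case: (comparable_leP (maxC x)) => h.
  by rewrite max_r // ler_pXn2r ?nnegrE.
by rewrite max_l // ler_pXn2r ?nnegrE // ltW.
Qed.

HB.instance Definition _ := isCStarAlgebra.Build R (A1 * A2)%type
  (@mulrA (A1 * A2)%type) (@mul1r (A1 * A2)%type) (@mulr1 (A1 * A2)%type)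
  (@mulrDl (A1 * A2)%type) (@mulrDr (A1 * A2)%type)
  dsum_scaleAl dsum_scaleAr dsum_starK dsum_starD dsum_starZ dsum_starM
  dsum_normM dsum_norm_starM.

End DirectSum.

Section StarHom.
Context (R : realType) (A D : cstarAlgType R).

Record unital_star_hom (f : A -> D) : Prop := {
  shom_linear : linear f;
  shom_mul : {morph f : x y / x * y};
  shom_one : f 1 = 1;
  shom_star : {morph f : x / star x}
}.

End StarHom.

Definition cstar_pos (R : realType) (A : cstarAlgType R) (x : A) : Prop :=
  exists y : A, x = star y * y.

Definition separable (T : topologicalType) : Prop :=
  exists D : set T, countable D /\ dense D.

(* [B] is regarded as a subalgebra of [A] through [i]. *)
Record conditional_expectation (R : realType) (B A : cstarAlgType R)
    (i : B -> A) (E : A -> B) : Prop := {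
  cexp_linear : linear E;
  cexp_id : forall b, E (i b) = b;
  cexp_bimod : forall b a b', E (i b * a * i b') = b * E a * b';
  cexp_pos : forall a, cstar_pos a -> cstar_pos (E a);
  cexp_contr : forall a, `|E a| <= `|a|
}.

(* Right Hilbert A-modules; the inner product is linear in its second variable.
   [inner_norm] makes the inner product definite and the module complete for
   the norm it defines. *)
HB.mixin Record isHilbertModule (R : realType) (A : cstarAlgType R) H
    & CompleteNormedModule R[i] H := {
  ract : H -> A -> H;
  inner : H -> H -> A;
  ractDl : forall (x y : H) (a : A), ract (x + y) a = ract x a + ract y a;
  ractDr : forall (x : H) (a b : A), ract x (a + b) = ract x a + ract x b;
  ractZl : forall (c : R[i]) (x : H) (a : A), ract (c *: x) a = c *: ract x a;
  ractZr : forall (c : R[i]) (x : H) (a : A), ract x (c *: a) = c *: ract x a;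
  ractM : forall (x : H) (a b : A), ract x (a * b) = ract (ract x a) b;
  ract1 : forall x : H, ract x 1 = x;
  innerDr : forall x y z : H, inner x (y + z) = inner x y + inner x z;
  innerZr : forall (c : R[i]) (x y : H), inner x (c *: y) = c *: inner x y;
  inner_ract : forall (x y : H) (a : A), inner x (ract y a) = inner x y * a;
  inner_star : forall x y : H, star (inner x y) = inner y x;
  inner_pos : forall x : H, cstar_pos (inner x x);
  inner_norm : forall x : H, `|x| ^+ 2 = `|inner x x|
}.

#[short(type="hilbertModType")]
HB.structure Definition HilbertModule (R : realType) (A : cstarAlgType R) :=
  {H of isHilbertModule R A H & CompleteNormedModule R[i] H}.

Definition hself (R : realType) (A : cstarAlgType R) : Type := A.

Section SelfModule.
Context (R : realType) (A : cstarAlgType R).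

HB.instance Definition _ := CompleteNormedModule.copy (hself A) A.

Let sract (x : hself A) (a : A) : hself A := (x : A) * a.
Let sinner (x y : hself A) : A := star (x : A) * (y : A).

Let sractDl x y a : sract (x + y) a = sract x a + sract y a.
Proof. exact: mulrDl. Qed.
Let sractDr x a b : sract x (a + b) = sract x a + sract x b.
Proof. exact: mulrDr. Qed.
Let sractZl (c : R[i]) x a : sract (c *: x) a = c *: sract x a.
Proof. exact/esym/cstar_scaleAl. Qed.
Let sractZr (c : R[i]) x a : sract x (c *: a) = c *: sract x a.
Proof. exact/esym/cstar_scaleAr. Qed.
Let sractM x a b : sract x (a * b) = sract (sract x a) b.
Proof. exact: mulrA. Qed.
Let sract1 x : sract x 1 = x. Proof. exact: mulr1. Qed.
Let sinnerDr x y z : sinner x (y + z) = sinner x y + sinner x z.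
Proof. exact: mulrDr. Qed.
Let sinnerZr (c : R[i]) x y : sinner x (c *: y) = c *: sinner x y.
Proof. exact/esym/cstar_scaleAr. Qed.
Let sinner_ract x y a : sinner x (sract y a) = sinner x y * a.
Proof. exact: mulrA. Qed.
Let sinner_star x y : star (sinner x y) = sinner y x.
Proof. by rewrite /sinner [LHS]starM starK. Qed.
Let sinner_pos x : cstar_pos (sinner x x). Proof. by exists x. Qed.
Let sinner_norm (x : hself A) : `|x| ^+ 2 = `|sinner x x|.
Proof. exact/esym/(cstar_norm_starM (x : A)). Qed.

HB.instance Definition _ := isHilbertModule.Build R A (hself A)
  sractDl sractDr sractZl sractZr sractM sract1
  sinnerDr sinnerZr sinner_ract sinner_star sinner_pos sinner_norm.

End SelfModule.

Definition closed_span (K : numFieldType) (V : normedModType K) (S : set V) :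
    set V :=
  closure [set v | exists n (c : 'I_n -> K) (f : 'I_n -> V),
    (forall j, S (f j)) /\ v = \sum_j c j *: f j].

Section Operators.
Context (R : realType) (A : cstarAlgType R).

Definition adjoint_pair (X Y : hilbertModType A) (T : X -> Y) (T' : Y -> X) :
    Prop :=
  forall x y, inner (T x) y = inner x (T' y).

(* A unital *-homomorphism from D to the adjointable operators of X. Having an
   adjoint makes each [pi d] A-linear. *)
Record star_representation (D : cstarAlgType R) (X : hilbertModType A)
    (pi : D -> X -> X) : Prop := {
  rep_star : forall d, adjoint_pair (pi d) (pi (star d));
  repD : forall d d' x, pi (d + d') x = pi d x + pi d' x;
  repZ : forall (c : R[i]) d x, pi (c *: d) x = c *: pi d x;
  repM : forall d d' x, pi (d * d') x = pi d (pi d' x);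
  rep1 : forall x, pi 1 x = x
}.

Definition opnorm (X : hilbertModType A) (T : X -> X) : R :=
  sup [set complex.Re `|T x| | x in [set x : X | `|x| <= 1]].

Record hilbert_isometry (X Y : hilbertModType A) (v : X -> Y) : Prop := {
  hiso_linear : linear v;
  hiso_ract : forall x (a : A), v (ract x a) = ract (v x) a;
  hiso_inner : forall x y, inner (v x) (v y) = inner x y
}.

(* S is the Hilbert module direct sum of the X j, for j in J; the values of
   [e] outside J are irrelevant. *)
Record direct_sum (I : Type) (J : set I) (X : I -> hilbertModType A)
    (S : hilbertModType A) (e : forall j, X j -> S) : Prop := {
  dsum_iso : forall j, J j -> hilbert_isometry (e j);
  dsum_orth : forall j j', J j -> J j' -> j <> j' ->
    forall x y, inner (e j x) (e j' y) = 0;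
  dsum_dense :
    closed_span [set z | exists j x, J j /\ z = e j x] = [set: S]
}.

End Operators.

(* T is the interior tensor product over B of the Hilbert B-module X and of the
   closed Hilbert A-submodule Y0 of Y, on which B acts by phi. The map t
   describes the simple tensors; its values outside X x Y0 are irrelevant. *)
Record interior_tensor (R : realType) (B A : cstarAlgType R)
    (X : hilbertModType B) (Y T : hilbertModType A) (phi : B -> Y -> Y)
    (Y0 : set Y) (t : X -> Y -> T) : Prop := {
  tensDl : forall x x' y, Y0 y -> t (x + x') y = t x y + t x' y;
  tensDr : forall x y y', Y0 y -> Y0 y' -> t x (y + y') = t x y + t x y';
  tensZl : forall (c : R[i]) x y, Y0 y -> t (c *: x) y = c *: t x y;
  tens_bal : forall x b y, Y0 y -> t (ract x b) y = t x (phi b y);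
  tens_ract : forall x y (a : A), Y0 y -> t x (ract y a) = ract (t x y) a;
  tens_inner : forall x x' y y', Y0 y -> Y0 y' ->
    inner (t x y) (t x' y') = inner y (phi (inner x x') y');
  tens_dense :
    closed_span [set z | exists x y, Y0 y /\ z = t x y] = [set: T]
}.

Record gns_construction (R : realType) (A B : cstarAlgType R) (E : A -> B)
    (K : hilbertModType B) (rho : A -> K -> K) (eta : K) : Prop := {
  gns_rep : star_representation rho;
  gns_cyclic :
    closed_span [set z | exists a b, z = ract (rho a eta) b] = [set: K];
  gns_inner : forall a, inner eta (rho a eta) = E a
}.

(* The submodule usually written K with a circle, where E : A -> B. *)
Definition gns_circ (R : realType) (A B : cstarAlgType R) (E : A -> B)
    (K : hilbertModType B) (rho : A -> K -> K) (eta : K) : set K :=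
  closed_span [set z | exists a b, E a = 0 /\ z = ract (rho a eta) b].

(* The indices 1 and 2 are [false] and [true], so that the other index is given
   by [~~]. An index sequence (i_1, ..., i_n) is split into its last letter
   l = i_n and w = (i_1, ..., i_{n-1}); its first letter is [head l w]. *)

Definition alternating (l : bool) (w : seq bool) : bool :=
  sorted (fun a b : bool => a != b) (rcons w l).

Definition words (k l : bool) : set (seq bool) :=
  [set w | alternating l w /\ head l w = k].

Section WordModules.
Context (R : realType) (B : cstarAlgType R) (A : bool -> cstarAlgType R).
Variable H : forall l : bool, bool -> seq bool -> hilbertModType (A l).

(* The module H_(w, l), where [H l k w'] is the one for (k, w', l). *)
Definition word_module (l : bool) (w : seq bool) : hilbertModType (A l) :=
  if w is k :: w' then H l k w' else hself (A l).

Variables (K : bool -> hilbertModType B) (K0 : forall k, set (K k)).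
Variable t : forall l k w, K k -> word_module l w -> word_module l (k :: w).

(* The subspace K0_{i_1} (x) ... (x) K0_{i_{n-1}} (x) A_l of H_(w, l). *)
Fixpoint word_circ (l : bool) (w : seq bool) : set (word_module l w) :=
  match w return set (word_module l w) with
  | [::] => setT
  | k :: w' => closed_span
      [set z | exists x xi, [/\ @K0 k x, @word_circ l w' xi & z = @t l k w' x xi]]
  end.

End WordModules.

Section VertexReduced.
Context (R : realType) (B : cstarAlgType R) (A : bool -> cstarAlgType R).
Variables (i : forall k, B -> A k) (E : forall k, A k -> B).

(* GNS constructions, interior tensor products and direct sums are only
   determined up to unitary equivalence: this structure collects a choice of
   them, with the maps that identify them. [vH l k w] is K_k (x)_B [vcirc l w],
   with the left action [vlam l (k :: w)] of A_k; [vS k l], [vLam k l], [vu k]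
   and [vustar k] are H_{k,l}, lambda_{k,l}, u_{k,k} and its adjoint. Only the
   modules of alternating words are constrained. *)
Record vertex_construction := VertexConstruction {
  vK : bool -> hilbertModType B;
  vrho : forall k, A k -> vK k -> vK k;
  veta : forall k, vK k;
  vgns : forall k, gns_construction (@E k) (@vrho k) (veta k);
  vH : forall l : bool, bool -> seq bool -> hilbertModType (A l);
  vtens : forall l k w,
    vK k -> word_module vH l w -> word_module vH l (k :: w);
  vlam : forall l w, A (head l w) -> word_module vH l w -> word_module vH l w;
  vcirc := word_circ (fun k => gns_circ (@E k) (@vrho k) (veta k)) vtens;
  vtensP : forall l k w, alternating l (k :: w) ->
    interior_tensor (fun b => @vlam l w (@i (head l w) b))
      (@vcirc l w) (@vtens l k w);
  vlam_rep : forall l w, alternating l w -> star_representation (@vlam l w);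
  vlam_nil : forall l (a x : A l), @vlam l [::] a x = (a * x : A l);
  vlam_cons : forall l k w (a : A k) x xi, alternating l (k :: w) ->
    @vcirc l w xi -> @vlam l (k :: w) a (vtens x xi) = vtens (vrho a x) xi;
  vS : bool -> forall l, hilbertModType (A l);
  vemb : forall k l w, word_module vH l w -> vS k l;
  vsum : forall k l, direct_sum (words k l) (@vemb k l);
  vLam : forall k l, A k -> vS k l -> vS k l;
  vLam_rep : forall k l, star_representation (@vLam k l);
  vLamE : forall l w a x, alternating l w ->
    vLam a (@vemb (head l w) l w x) = vemb (head l w) (vlam a x);
  vu : forall k, vS k k -> vS (~~ k) k;
  vustar : forall k, vS (~~ k) k -> vS k k;
  vu_adj : forall k, adjoint_pair (@vu k) (@vustar k);
  vuK : forall k, cancel (@vu k) (@vustar k);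
  vustarK : forall k, cancel (@vustar k) (@vu k);
  vu_nil : forall k (xi : A k),
    vu (@vemb k k [::] xi)
    = @vemb (~~ k) k [:: ~~ k] (@vtens k (~~ k) [::] (veta (~~ k)) xi);
  vu_circ : forall k w a (xi : word_module vH k w), alternating k (k :: w) ->
    vcirc xi -> E a = 0 ->
    vu (@vemb k k (k :: w) (vtens (vrho a (veta k)) xi))
    = @vemb (~~ k) k (~~ k :: k :: w)
        (vtens (veta (~~ k)) (vtens (vrho a (veta k)) xi));
  vu_base : forall k w b (xi : word_module vH k w), alternating k (k :: w) ->
    vcirc xi ->
    vu (@vemb k k (k :: w) (vtens (vrho (i k b) (veta k)) xi))
    = vemb (~~ k) (vlam (i (head k w) b) xi)
}.

Record amalgamated_free_product (Af : cstarAlgType R)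
    (j : forall k, A k -> Af) : Prop := {
  afp_hom : forall k, unital_star_hom (@j k);
  afp_amalg : forall b, @j false (i false b) = @j true (i true b);
  afp_univ : forall (D : cstarAlgType R) (f : forall k, A k -> D),
    (forall k, unital_star_hom (@f k)) ->
    (forall b, f false (i false b) = f true (i true b)) ->
    exists! g : Af -> D,
      unital_star_hom g /\ forall k (a : A k), g (@j k a) = f k a
}.

Record vertex_representation (V : vertex_construction) (Af : cstarAlgType R)
    (j : forall k, A k -> Af) (k : bool) (pi : Af -> vS V k k -> vS V k k) :
    Prop := {
  vrep_rep : star_representation pi;
  vrep_same : forall (a : A k) x, pi (@j k a) x = vLam a x;
  vrep_other : forall (a : A (~~ k)) x,
    pi (@j (~~ k) a) x = vustar (vLam a (vu x))
}.

Definition vertex_seminorm (V : vertex_construction) (Af : cstarAlgType R)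
    (pi : forall k, Af -> vS V k k -> vS V k k) (x : Af) : R :=
  Num.max (opnorm (@pi false x)) (opnorm (@pi true x)).

End VertexReduced.

Record separation_completion (R : realType) (A D : cstarAlgType R)
    (p : A -> R) (q : A -> D) : Prop := {
  scompl_hom : unital_star_hom q;
  scompl_dense : dense (range q);
  scompl_norm : forall x, `|q x| = (p x)%:C
}.

Definition fibre_sum (R : realType) (B : cstarAlgType R)
    (A : bool -> cstarAlgType R) (E : forall k, A k -> B) :
    set (A false * A true) :=
  [set a | @E false a.1 = @E true a.2].

(* Main.v *)
(* When E_k is a homomorphism, rho_k(a) eta_k = eta_k . E_k(a), so K_k is
   eta_k . B and the complement of eta_k . B in K_k vanishes. Hence H_w = 0 for
   every alternating word of length at least three, H_{k,k} is the trivial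
   A_k-module A_k, and pi_k is left multiplication by a homomorphism
   theta_k : A_f -> A_k which is the identity on A_k and E_{k'} on A_{k'} for
   the other index k'. So the seminorm of x is the norm of
   Theta(x) = (theta_1(x), theta_2(x)). The image of Theta lies in the fibre
   sum by the uniqueness part of the universal property, and is all of it, as
   (a_1, a_2) = Theta(a_1 + a_2 - b) with b = E_1(a_1) = E_2(a_2). Being
   isometric to the closed fibre sum, the image of A_f in A_v is complete, hence
   equal to A_v, and Theta descends to the required isomorphism. *)
Require Import Defs.
From HB Require Import structures.
From mathcomp Require Import all_boot all_order all_algebra complex.
From mathcomp Require Import all_classical all_reals.
From mathcomp Require Import prodnormedzmodule topology normedtype
  interval_inference.

Set Implicit Arguments.
Unset Strict Implicit.
Unset Printing Implicit Defensive.

Import Order.TTheory GRing.Theory Num.Theory.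
Import numFieldNormedType.Exports.

Local Open Scope classical_set_scope.
Local Open Scope ring_scope.

(** * Closed sets and linear maps in normed spaces *)

Lemma isometric_image_closed (K : numFieldType) (U : completeNormedModType K)
    (W : normedModType K) (D : set U) (g : U -> W) :
  closed D -> (forall x y, D x -> D y -> `|g x - g y| = `|x - y|) ->
  closed (g @` D).
Proof.
move=> Dcl giso y ycl.
have [x0 _] : exists x0, D x0.
  by have [_ [[x Dx _] _]] := ycl _ (@filterT _ (nbhs y) _); exists x.
have /choice[h hP] : forall w : W, exists x, (g @` D) w -> D x /\ g x = w.
  move=> w; have [[x Dx gx]|nw] := pselect ((g @` D) w).
    by exists x.
  by exists x0 => /nw.
have PF : ProperFilter (within (g @` D) (nbhs y)) by exact: within_nbhs_proper.
pose F := h @ within (g @` D) (nbhs y).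
have Fc : cauchy F.
  apply: cauchy_exP => e e0.
  have e20 : 0 < e / 2 by rewrite divr_gt0.
  have [w [wD yw]] := ycl _ (nbhsx_ballx y _ e20).
  exists (h w); apply: filterS (nbhsx_ballx y _ e20) => w' yw' w'D.
  have [Dw gw] := hP _ wD; have [Dw' gw'] := hP _ w'D.
  rewrite /= -ball_normE /= -giso // gw gw'.
  by move: (ball_splitr yw yw'); rewrite -ball_normE.
have [u Fu] := (iffLR (@cvg_ex U F)) (@cauchy_cvg U F _ Fc).
have Du : D u.
  apply: (@closed_cvg _ _ _ PF h D Dcl _ u Fu).
  by apply: filterS (@filterT _ (nbhs y) _) => w _ wD; exact: (hP _ wD).1.
(* By separation it suffices that [y] and [g u] are arbitrarily close: some [w] near [y] has [h w]
   near [u], and the isometry carries this to [w = g (h w)] near [g u]. *)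
exists u => //; rewrite -norm_closeE ball_close => /= e.
have e20 : 0 < e%:num / 2 by rewrite divr_gt0.
have Fu2 : F (ball u (e%:num / 2)) by apply: Fu; exact: nbhsx_ballx.
have [w [wD [yw /(_ wD) wu]]] := ycl _ (filterI (nbhsx_ballx y _ e20) Fu2).
have [Dw gw] := hP _ wD.
apply: (@ball_splitl _ _ w) => //; rewrite -ball_normE /= -gw giso //.
by move: wu; rewrite -ball_normE.
Qed.

Section LinearFunctions.
Context (K : pzRingType) (U W : lmodType K) (f : U -> W).
Hypothesis f_linear : linear f.

Lemma linear_funD : {morph f : x y / x + y}.
Proof. by move=> x y; rewrite -[x in LHS]scale1r f_linear scale1r. Qed.

Lemma linear_fun0 : f 0 = 0.
Proof. by apply: (addrI (f 0)); rewrite -linear_funD !addr0. Qed.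

Lemma linear_funZ c : {morph f : x / c *: x}.
Proof. by move=> x; rewrite -[c *: x]addr0 f_linear linear_fun0 addr0. Qed.

Lemma linear_funB : {morph f : x y / x - y}.
Proof.
by move=> x y; rewrite -scaleN1r linear_funD linear_funZ scaleN1r.
Qed.

End LinearFunctions.

Lemma linear_contraction_continuous (K : numFieldType) (U W : normedModType K)
    (f : U -> W) :
  linear f -> (forall x, `|f x| <= `|x|) -> continuous f.
Proof.
move=> fl f1 x; apply/cvgrPdist_lt => e e0; near=> y.
rewrite -(linear_funB fl); apply: le_lt_trans (f1 _) _.
by near: y; exact: cvgr_dist_lt.
Unshelve. all: by end_near. Qed.

(** * Inner products, adjoints and isometries of Hilbert modules *)

Section HilbertModules.
Context (R : realType) (A : cstarAlgType R).
Implicit Types (X Y : hilbertModType A).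

Lemma star0 : star 0 = 0 :> A.
Proof. by apply: (addrI (star 0)); rewrite -starD !addr0. Qed.

Lemma star1 : star 1 = 1 :> A.
Proof.
rewrite -[RHS]starK -[X in _ = star X]mul1r [RHS]starM starK.
exact/esym/mul1r.
Qed.

Lemma innerBr X (x y z : X) : inner x (y - z) = inner x y - inner x z.
Proof. by rewrite innerDr -scaleN1r innerZr scaleN1r. Qed.

Lemma inner_ext X (x y : X) : (forall z, inner z x = inner z y) -> x = y.
Proof.
move=> xy; apply/eqP; rewrite -subr_eq0 -normr_eq0 -sqrf_eq0.
by rewrite inner_norm innerBr xy subrr normr0.
Qed.

Lemma ractr0 X (x : X) : ract x 0 = 0.
Proof. by apply: (addrI (ract x 0)); rewrite -ractDr !addr0. Qed.

Lemma inner_ractl X (x y : X) (a : A) : inner (ract x a) y = star a * inner x y.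
Proof. by rewrite -inner_star inner_ract [LHS]starM inner_star. Qed.

Lemma adjoint_pair_sym X Y (T : X -> Y) (T' : Y -> X) :
  adjoint_pair T T' -> adjoint_pair T' T.
Proof. by move=> h y x; rewrite -inner_star -h inner_star. Qed.

Lemma adjoint_pair_ract X Y (T : X -> Y) (T' : Y -> X) :
  adjoint_pair T T' -> forall x a, T (ract x a) = ract (T x) a.
Proof.
move=> /adjoint_pair_sym h x a; apply: inner_ext => z.
by rewrite -h !inner_ract h.
Qed.

Lemma hilbert_isometry_norm X Y (v : X -> Y) :
  hilbert_isometry v -> forall x, `|v x| = `|x|.
Proof.
move=> hv x; apply/eqP; rewrite -(@eqrXn2 _ 2)//.
by rewrite !inner_norm hiso_inner.
Qed.

Lemma hilbert_isometry_range_closed X Y (v : X -> Y) :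
  hilbert_isometry v -> closed (range v).
Proof.
move=> hv; apply: isometric_image_closed; first exact: closedT.
move=> x y _ _; rewrite -(hilbert_isometry_norm hv (x - y)).
by rewrite -(linear_funB (hiso_linear hv)).
Qed.

(** The hypotheses make [x - y] orthogonal to both [x] and [y], hence to itself. *)
Lemma inner_eq X (x y : X) :
  inner x x = inner x y -> inner y y = inner y x -> x = y.
Proof.
move=> xx yy; have ext0 z : inner z (x - y) = 0 -> inner (x - y) z = 0.
  by move=> h; rewrite -inner_star h star0.
apply/eqP; rewrite -subr_eq0 -normr_eq0 -sqrf_eq0 inner_norm innerBr.
by rewrite !ext0 ?subrr ?normr0// innerBr ?xx ?yy subrr.
Qed.

End HilbertModules.

Lemma normed_closed_set1 (K : numFieldType) (V : normedModType K) (x : V) :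
  closed [set x].
Proof.
apply: accessible_closed_set1.
exact/hausdorff_accessible/norm_hausdorff.
Qed.

Lemma closed_span_eq0 (K : numFieldType) (V : normedModType K) (S : set V) :
  (forall z, S z -> z = 0) -> forall z, closed_span S z -> z = 0.
Proof.
move=> S0 z Sz; suff : closure [set (0 : V)] z.
  by rewrite -(closure_id _).1 //; exact: normed_closed_set1.
apply: closureS Sz => _ [n [c [f [Sf ->]]]].
by rewrite /= big1// => j _; rewrite (S0 _ (Sf j)) scaler0.
Qed.

(** * The GNS module of a homomorphism, and interior tensor products *)

Section Gns.
Context (R : realType) (A B : cstarAlgType R) (E : A -> B).
Context (K : hilbertModType B) (rho : A -> K -> K) (eta : K).
Hypotheses (gns : gns_construction E rho eta) (E_hom : unital_star_hom E).

(** As [E] is a *-homomorphism, all inner products among these two vectors equal [star (E a) * E a],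
    so [inner_eq] applies. *)
Lemma gns_hom_cyclic a : rho a eta = ract eta (E a).
Proof.
have rs := rep_star (gns_rep gns); have gi := gns_inner gns.
have ee : inner eta eta = 1.
  by rewrite -(shom_one E_hom) -gi (rep1 (gns_rep gns)).
apply: inner_eq; rewrite ?inner_ractl ?inner_ract.
  by rewrite !rs -(repM (gns_rep gns)) !gi (shom_mul E_hom).
by rewrite ee mul1r gi.
Qed.

Lemma gns_hom_circ x : gns_circ E rho eta x -> x = 0.
Proof.
apply: closed_span_eq0 => _ [a [b [Ea ->]]].
by rewrite gns_hom_cyclic Ea -ractM mul0r ractr0.
Qed.

End Gns.

Section InteriorTensor.
Context (R : realType) (B A : cstarAlgType R) (X : hilbertModType B).
Context (Y T : hilbertModType A) (phi : B -> Y -> Y) (Y0 : set Y).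
Variable t : X -> Y -> T.
Hypothesis tP : interior_tensor phi Y0 t.

Lemma tens0l y : Y0 y -> t 0 y = 0.
Proof.
by move=> Yy; apply: (addrI (t 0 y)); rewrite -(tensDl tP) ?addr0.
Qed.

Lemma tens0r x : Y0 0 -> t x 0 = 0.
Proof.
by move=> Yy; apply: (addrI (t x 0)); rewrite -(tensDr tP) ?addr0.
Qed.

End InteriorTensor.

(** * Collapse of the vertex construction *)

Section Vertex.
Context (R : realType) (B : cstarAlgType R) (A : bool -> cstarAlgType R).
Context (i : forall k : bool, B -> A k) (E : forall k : bool, A k -> B).
Context (V : vertex_construction i E).
Hypothesis E_hom : forall k, unital_star_hom (@E k).

(** Every simple tensor spanning this subspace has its left factor in the circle submodule of [K_k],
    which vanishes by [gns_hom_circ]. *)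
Lemma vcirc_cons_eq0 l k w (xi : word_module (vH V) l (k :: w)) :
  alternating l (k :: w) -> vcirc xi -> xi = 0.
Proof.
move=> kw; apply: closed_span_eq0 => _ [x [y [x0 y0 ->]]].
by rewrite (gns_hom_circ (vgns V k) (E_hom k) x0) (tens0l (vtensP V kw)).
Qed.

(** Here it is the right factor of each spanning tensor that vanishes, by [vcirc_cons_eq0]. *)
Lemma word_module_cons2_eq0 l k k' w
    (x : word_module (vH V) l (k :: k' :: w)) :
  alternating l (k :: k' :: w) -> x = 0.
Proof.
move=> kw; have k'w : alternating l (k' :: w) := path_sorted kw.
have : [set: word_module (vH V) l (k :: k' :: w)] x by [].
rewrite -(tens_dense (vtensP V kw)); apply: closed_span_eq0.
move=> _ [y [xi [xi0 ->]]]; move: (xi0).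
rewrite (vcirc_cons_eq0 k'w xi0); exact: (tens0r (vtensP V kw)).
Qed.

Lemma vemb_iso k l w :
  words k l w -> hilbert_isometry (@vemb _ _ _ _ _ V k l w).
Proof. exact: (dsum_iso (vsum V k l)). Qed.

Lemma adjacent_alternating k : alternating k [:: ~~ k].
Proof. by case: k. Qed.

Lemma nil_words k : words k k [::].
Proof. by []. Qed.

Let vemb_nil k : hself (A k) -> vS V k k := @vemb _ _ _ _ _ V k k [::].

Lemma vemb_nil_surj k (z : vS V k k) : exists x, z = vemb_nil x.
Proof.
have iso := vemb_iso (nil_words k).
suff : range (@vemb_nil k) z by case=> x _ <-; exists x.
rewrite (iffLR (closure_id _) (hilbert_isometry_range_closed iso)).
have : [set: vS V k k] z by [].
rewrite -(dsum_dense (vsum V k k)); apply: closureS => _ [n [c [f [Sf ->]]]].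
suff /choice[g gP] : forall m, exists x, f m = vemb_nil x.
  exists (\sum_m c m *: g m) => //; apply/esym.
  under eq_bigr do rewrite gP -(linear_funZ (hiso_linear iso)).
  elim/big_ind2 : _ => [|x x' y y' -> ->|//].
    by rewrite (linear_fun0 (hiso_linear iso)).
  by rewrite (linear_funD (hiso_linear iso)).
(* The empty word gives the summand [A_k]; a single letter would have to be [k], which does not
   alternate with the final [k]; longer words have zero module. *)
move=> m; case: (Sf m) => -[|a [|b w]] [x [[alt hd] ->]].
- by exists x.
- by exfalso; move: hd alt; rewrite /alternating /= => ->; rewrite eqxx.
- exists 0; rewrite (word_module_cons2_eq0 x alt).
  rewrite (linear_fun0 (hiso_linear (vemb_iso (conj alt hd)))).
  exact/esym/(linear_fun0 (hiso_linear iso)).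
Qed.

(** * The representation [pi_k] as left multiplication *)

Section Representation.
Context (Af : cstarAlgType R) (j : forall k, A k -> Af) (k : bool).
Context (pi : Af -> vS V k k -> vS V k k).
Hypothesis pi_rep : vertex_representation j pi.

Let rs := vrep_rep pi_rep.

(* [pi x] is left multiplication by [vertex_coef x]. *)
Definition vertex_coef (x : Af) : A k :=
  inner (vemb_nil (1 : A k)) (pi x (vemb_nil (1 : A k))).

Lemma vertex_coefP x (c : A k) :
  pi x (vemb_nil (1 : A k)) = vemb_nil c -> vertex_coef x = c.
Proof.
move=> pix; rewrite /vertex_coef pix (hiso_inner (vemb_iso (nil_words k))).
by rewrite -[LHS]/(star (1 : A k) * c) star1 mul1r.
Qed.

(** An adjointable map commutes with the right action, so on the copy of [A_k], generated by 1, it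
    is determined by its value at 1. *)
Lemma vertex_repE x (y : A k) :
  pi x (vemb_nil y) = vemb_nil (vertex_coef x * y).
Proof.
have iso := vemb_iso (nil_words k).
have [c pix] := vemb_nil_surj (pi x (vemb_nil (1 : A k))).
have nilE (z : A k) : vemb_nil z = ract (vemb_nil (1 : A k)) z.
  by rewrite -(hiso_ract iso); congr vemb_nil; exact/esym/mul1r.
rewrite nilE (adjoint_pair_ract (rep_star rs x)) pix (vertex_coefP pix).
by rewrite -(hiso_ract iso).
Qed.

Lemma vertex_coef_hom : unital_star_hom vertex_coef.
Proof.
split.
- move=> a x y; rewrite /vertex_coef (repD rs) (repZ rs).
  by rewrite innerDr innerZr.
- move=> x y; apply: vertex_coefP.
  by rewrite (repM rs) !vertex_repE mulr1.
- by apply: vertex_coefP; rewrite (rep1 rs).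
- by move=> x; rewrite /vertex_coef -(rep_star rs) inner_star.
Qed.

Lemma vertex_coef_same a : vertex_coef (j a) = a.
Proof.
apply: vertex_coefP; rewrite (vrep_same pi_rep).
by rewrite (@vLamE _ _ _ _ _ V k [::]) // vlam_nil mulr1.
Qed.

(** [u] sends 1 to [eta] tensor 1, and [a] turns this into [eta . E a] tensor 1. Balancing moves
    [E a] across, giving the image under [u] of [i k (E a)]. *)
Lemma vertex_coef_other a : vertex_coef (@j (~~ k) a) = i k (E a).
Proof.
apply: vertex_coefP; rewrite (vrep_other pi_rep) vu_nil.
have alt := adjacent_alternating k.
rewrite (@vLamE _ _ _ _ _ V k [:: ~~ k]) // vlam_cons //.
rewrite (gns_hom_cyclic (vgns V (~~ k)) (E_hom _)).
by rewrite (tens_bal (vtensP V alt)) // vlam_nil mulr1 -vu_nil vuK.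
Qed.

Lemma vertex_opnorm x : ((opnorm (pi x))%:C)%C = `|vertex_coef x|.
Proof.
have iso := vemb_iso (nil_words k).
(* The C*-identity at 1 makes this norm idempotent, so it is 1, or 0 in the zero algebra. *)
have norm1 : `|1 : A k| <= 1.
  have := cstar_norm_starM (1 : A k); rewrite star1 [cstar_mul _ _]mul1r.
  move=> /eqP; rewrite -subr_eq0 expr2 -{1}[`|_|]mulr1 -mulrBr mulf_eq0 subr_eq0.
  by case/orP => [/eqP -> //|/eqP <-].
have pi_norm z : `|z| <= 1 -> `|pi x z| <= `|vertex_coef x|.
  have [y ->] := vemb_nil_surj z; rewrite vertex_repE.
  rewrite !(hilbert_isometry_norm iso) => y1.
  apply: le_trans (cstar_normM _ _) _; exact: ler_piMr.
have pi_ub : ubound [set complex.Re `|pi x z| | z in [set z | `|z| <= 1]]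
    (complex.Re `|vertex_coef x|).
  by move=> _ [z /= z1 <-]; have := pi_norm z z1; rewrite lecE => /andP[].
rewrite -[RHS](RRe_real (normr_real _)); congr (_%:C)%C.
apply/le_anti/andP; split.
  apply: ge_sup => //.
  by exists (complex.Re `|pi x 0|), 0 => //=; rewrite normr0.
(* The supremum is attained at the unit of [A_k]. *)
apply: ub_le_sup; first by exists (complex.Re `|vertex_coef x|).
exists (vemb_nil (1 : A k)); first by rewrite /= (hilbert_isometry_norm iso).
by rewrite vertex_repE mulr1 (hilbert_isometry_norm iso).
Qed.

End Representation.

End Vertex.

(** * The isomorphism with the fibre sum *)

Theorem corollary2p9 (R : realType)
  (* A_1 = A false and A_2 = A true, both containing B through i *)
  (B : cstarAlgType R) (A : bool -> cstarAlgType R)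
  (i : forall k : bool, B -> A k) (E : forall k : bool, A k -> B)
  (A_separable : forall k, separable (A k))
  (i_hom : forall k, unital_star_hom (i k))
  (i_isometric : forall k b, `|i k b| = `|b|)
  (E_cexp : forall k, conditional_expectation (i k) (E k))
  (* the vertex-reduced amalgamated free product (Av, q) *)
  (Af : cstarAlgType R) (j : forall k : bool, A k -> Af)
  (Af_free : amalgamated_free_product i j)
  (V : vertex_construction i E)
  (pi : forall k : bool, Af -> vS V k k -> vS V k k)
  (pi_rep : forall k, vertex_representation j (pi k))
  (Av : cstarAlgType R) (q : Af -> Av)
  (Av_compl : separation_completion (vertex_seminorm pi) q)
  (E_hom : forall k, unital_star_hom (E k)) :
  exists Phi : Av -> (A false * A true)%type,
    [/\ unital_star_hom Phi,
        forall x, `|Phi x| = `|x|,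
        range Phi = fibre_sum E,
        forall a : A false, Phi (q (j false a)) = (a, i true (E false a))
      & forall a : A true, Phi (q (j true a)) = (i false (E true a), a)].
Proof.
pose th k : Af -> A k := vertex_coef (pi k).
have th_hom k : unital_star_hom (th k).
  exact: (vertex_coef_hom E_hom (pi_rep k)).
have th_same k a : th k (j k a) = a.
  exact: (vertex_coef_same (pi_rep k)).
have th_other k a : th k (j (~~ k) a) = i k (E (~~ k) a).
  exact: (vertex_coef_other E_hom (pi_rep k)).
have EiK k b : E k (i k b) = b := cexp_id (E_cexp k) b.
have q_hom := scompl_hom Av_compl.
pose Th x : (A false * A true)%type := (th false x, th true x).
have Th_hom : unital_star_hom Th.
  split.
  - by move=> a x y; rewrite /Th !(shom_linear (th_hom _)).
  - by move=> x y; rewrite /Th !(shom_mul (th_hom _)).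
  - by rewrite /Th !(shom_one (th_hom _)).
  - by move=> x; rewrite /Th !(shom_star (th_hom _)).
have Th_false a : Th (j false a) = (a, i true (E false a)).
  by rewrite /Th th_same (th_other true).
have Th_true a : Th (j true a) = (i false (E true a), a).
  by rewrite /Th th_same (th_other false).
have Th_norm x : `|q x| = `|Th x|.
  rewrite (scompl_norm Av_compl) prod_normE /=.
  rewrite -!(vertex_opnorm E_hom (pi_rep _)).
  rewrite /vertex_seminorm; case: leP => [h|/ltW h].
    by rewrite max_r // lecR.
  by rewrite max_l // lecR.
have Th_fibre x : fibre_sum E (Th x).
  (* The universal property is applied with target [B] and the maps [E k]; both composites
     [E k \o th k] restrict to [E l] on each [A l], so they coincide. *)
  have [g [_ gU]] := afp_univ Af_free E_hom
    (fun b => etrans (EiK false b) (esym (EiK true b))).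
  have comp_hom k : unital_star_hom (E k \o th k).
    split.
    - move=> a y z /=.
      by rewrite (shom_linear (th_hom _)) (shom_linear (E_hom _)).
    - by move=> y z /=; rewrite (shom_mul (th_hom _)) (shom_mul (E_hom _)).
    - by rewrite /= (shom_one (th_hom _)) (shom_one (E_hom _)).
    - by move=> y /=; rewrite (shom_star (th_hom _)) (shom_star (E_hom _)).
  have gE k : g = E k \o th k.
    apply: gU; split=> // l a /=.
    case: k l a => -[] a; rewrite ?th_same //.
      by rewrite (th_other true) EiK.
    by rewrite (th_other false) EiK.
  by rewrite /fibre_sum /=; have := gE false; rewrite (gE true) => /funeqP/(_ x).
pose lift (z : A false * A true) : Af :=
  j false z.1 + j true z.2 - j false (i false (E false z.1)).
(* With [b] the common value of the expectations, the three terms of [lift z] go to [(z1, b)],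
   [(b, z2)] and [(b, b)]. *)
have liftK z : fibre_sum E z -> Th (lift z) = z.
  case: z => z1 z2; rewrite /fibre_sum /lift /= => zE.
  rewrite (linear_funB (shom_linear Th_hom)) (linear_funD (shom_linear Th_hom)).
  rewrite !Th_false Th_true EiK -zE.
  by congr pair => /=; rewrite ?addrK// addrC addKr.
have Th_normB x y : `|q x - q y| = `|Th x - Th y|.
  rewrite -(linear_funB (shom_linear Th_hom)).
  by rewrite -(linear_funB (shom_linear q_hom)) Th_norm.
have q_lift x : q (lift (Th x)) = q x.
  by apply/eqP; rewrite -subr_eq0 -normr_eq0 Th_normB liftK // subrr normr0.
have fibre_closed : closed (fibre_sum E).
  have Ec k : continuous (E k).
    apply: linear_contraction_continuous (cexp_contr (E_cexp k)).
    exact: shom_linear (E_hom k).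
  have -> : fibre_sum E = (fun z => E false z.1 - E true z.2) @^-1` [set 0].
    apply/seteqP; split=> z; rewrite /fibre_sum /= => /eqP zE; apply/eqP.
      by rewrite subr_eq0.
    by rewrite -subr_eq0.
  apply: (iffLR (continuous_closedP _)).
    move=> z; apply: (@cvgB _ B).
      apply: (@cvg_comp _ _ _ fst (E false) _ (nbhs z.1)); last exact: Ec.
      exact: cvg_fst.
    apply: (@cvg_comp _ _ _ snd (E true) _ (nbhs z.2)); last exact: Ec.
    exact: cvg_snd.
  exact: normed_closed_set1.
(* By [q_lift], the image of the fibre sum under [q \o lift] contains the dense range of [q]; it is
   closed because [q \o lift] is isometric there. *)
have q_surj y : exists x, q x = y.
  have cl : closed ((q \o lift) @` fibre_sum E).
    apply: isometric_image_closed => // z z' zE z'E /=.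
    by rewrite Th_normB !liftK.
  suff : ((q \o lift) @` fibre_sum E) y by case=> z _ <-; exists (lift z).
  rewrite (iffLR (closure_id _) cl).
  move=> N; rewrite nbhsE => -[O [oO Oy] ON].
  have [v [Ov [x _ xv]]] := scompl_dense Av_compl (ex_intro _ y Oy) oO.
  exists v; split; last exact: ON.
  by exists (Th x); rewrite //= q_lift.
(* [s] is an arbitrary set-theoretic section of [q]. Since [q] and [Th] induce the same distances,
   [Th \o s] does not depend on it and inherits the algebraic identities. *)
have /choice[s qs] := q_surj.
have Th_s x : Th (s (q x)) = Th x.
  by apply/eqP; rewrite -subr_eq0 -normr_eq0 -Th_normB qs subrr normr0.
exists (Th \o s); split.
- split.
  + move=> a x y /=; rewrite -[x in LHS]qs -[y in LHS]qs.
    by rewrite -(shom_linear q_hom) Th_s (shom_linear Th_hom).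
  + move=> x y /=; rewrite -[x in LHS]qs -[y in LHS]qs.
    by rewrite -(shom_mul q_hom) Th_s (shom_mul Th_hom).
  + by rewrite /= -(shom_one q_hom) Th_s (shom_one Th_hom).
  + move=> x /=; rewrite -[x in LHS]qs.
    by rewrite -(shom_star q_hom) Th_s (shom_star Th_hom).
- by move=> x; rewrite /= -Th_norm qs.
- apply/seteqP; split=> [_ [x _ <-]|z zE]; first exact: Th_fibre.
  by exists (q (lift z)) => //=; rewrite Th_s liftK.
- by move=> a; rewrite /= Th_s.
- by move=> a; rewrite /= Th_s.
Qed.
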